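(* Let $l,r\in H'$ and let $F_{l,r}:\ \mathbb{R}^n_+\to\mathbb{R}$, $F_{l,r}(\sigma):=r(\tilde u_\sigma^l)$. Then $$F_{l,r}(\sigma)=b_\sigma(\tilde u_\sigma^l,\tilde u_\sigma^r)\quad\text{for all }\sigma\in\mathbb{R}^n_+.$$ Moreover, $F_{l,r}:\ \mathbb{R}^n_+\to\mathbb{R}$ is infinitely often differentiable and its first derivatives fulfill, for all $\sigma\in\mathbb{R}^n_+$, $$\frac{\partial}{\partial\sigma_i}F_{l,r}(\sigma)=-b_i(\tilde u_\sigma^l,\tilde u_\sigma^r),\quad i=1,\ldots,n.$$
   Context: Setting: $H$ is a real Hilbert space and $H'=\mathcal L(H,\mathbb{R})$ is its dual. Let $n\in\mathbb{N}$ and let $b_0,b_1,\ldots,b_n:\ H\times H\to\mathbb{R}$ be bounded, symmetric and positive semidefinite bilinear forms. For $\sigma=(\sigma_1,\ldots,\sigma_n)\in\mathbb{R}^n$ set $$b_\sigma(u,v):=b_0(u,v)+\sum_{i=1}^n\sigma_i\, b_i(u,v).$$ With $\mathbf 1:=(1,\ldots,1)^T\in\mathbb{R}^n$, it is assumed that there are constants $\beta,C>0$ with $C\|v\|^2\ge b_{\mathbf 1}(v,v)\ge\beta\|v\|^2$ for all $v\in H$. $\mathbb{R}^n_+$ denotes the set of all $\sigma\in\mathbb{R}^n$ with all entries strictly positive; for such $\sigma$ the form $b_\sigma$ is symmetric, bounded and coercive. Let $V\subset H$ be a finite-dimensional subspace (the finite element space). For $\sigma\in\mathbb{R}^n_+$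 and $l\in H'$ (and likewise $r\in H'$), $\tilde u_\sigma^l\in V$ denotes the unique solution of $b_\sigma(\tilde u_\sigma^l,v)=l(v)$ for all $v\in V$. *)

(* Defs.v *)
From HB Require Import structures.
From mathcomp Require Import all_boot all_order all_algebra.
From mathcomp Require Import all_classical all_reals all_analysis.
Import Order.TTheory GRing.Theory Num.Theory.
Import numFieldNormedType.Exports.

Set Implicit Arguments.
Unset Strict Implicit.
Unset Printing Implicit Defensive.

Local Open Scope classical_set_scope.
Local Open Scope ring_scope.

(* Setting: H is a complete normed space whose norm comes from an inner product
   ip, i.e. a real Hilbert space; this is recorded by [hilbert_norm ip]. *)
Definition hilbert_norm (R : realType) (H : normedModType R)
    (ip : {dot H for idfun}) : Prop :=
  forall x : H, `|x| ^+ 2 = ip x x.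

Definition bounded_form (R : realType) (H : normedModType R)
    (f : H -> H -> R) : Prop :=
  exists M : R, forall u v : H, `|f u v| <= M * `|u| * `|v|.

Definition psd_form (R : realType) (H : normedModType R)
    (f : H -> H -> R) : Prop :=
  forall v : H, 0 <= f v v.

Definition fin_dim_subspace (R : realType) (H : lmodType R) (V : set H) : Prop :=
  exists (m : nat) (e : 'I_m -> H),
    V = [set \sum_(j < m) c j *: e j | c in [set: 'I_m -> R]].

Definition pos_orthant (R : realType) (n : nat) : set 'rV[R]_n :=
  [set s | forall i : 'I_n, 0 < s ord0 i].

Definition bsigma (R : realType) (H : lmodType R) (n : nat)
    (b0 : H -> H -> R) (b : 'I_n -> H -> H -> R) (s : 'rV[R]_n) (u v : H) : R :=
  b0 u v + \sum_(i < n) s ord0 i * b i u v.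

Definition galerkin_eq (R : realType) (H : lmodType R) (n : nat)
    (b0 : H -> H -> R) (b : 'I_n -> H -> H -> R) (V : set H) (l : H -> R)
    (s : 'rV[R]_n) : set H :=
  [set u | V u /\ forall v, V v -> bsigma b0 b s u v = l v].

(* The default value 0 is irrelevant for s in the positive orthant: see
   [galerkin_sol_unique] at the end of this file. *)
Definition galerkin_sol (R : realType) (H : lmodType R) (n : nat)
    (b0 : H -> H -> R) (b : 'I_n -> H -> H -> R) (V : set H) (l : H -> R)
    (s : 'rV[R]_n) : H :=
  xget 0 (galerkin_eq b0 b V l s).

(* Only the values at s in the positive orthant are meaningful. *)
Definition F_map (R : realType) (H : lmodType R) (n : nat)
    (b0 : H -> H -> R) (b : 'I_n -> H -> H -> R) (V : set H) (l r : H -> R)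
    (s : 'rV[R]_n) : R :=
  r (galerkin_sol b0 b V l s).

(* k-fold (Frechet) differentiability on an open set U of R^n: the derivative
   of f is given by its n partial derivatives, so f is (k+1) times
   differentiable iff it is differentiable and each partial derivative is k
   times differentiable. *)
Fixpoint times_differentiable (R : realType) (n k : nat) (U : set 'rV[R]_n)
    (f : 'rV[R]_n -> R) : Prop :=
  if k is k'.+1 then
    (forall x, U x -> differentiable f x) /\
    (forall i : 'I_n,
        times_differentiable k' U (fun x => 'D_(delta_mx ord0 i) f x))
  else True.

Definition infinitely_differentiable (R : realType) (n : nat)
    (U : set 'rV[R]_n) (f : 'rV[R]_n -> R) : Prop :=
  forall k : nat, times_differentiable k U f.

Lemma galerkin_sol_unique (R : realType) (H : normedModType R) (n : nat)
    (b0 : {symmetric H}) (b : 'I_n -> {symmetric H}) (beta : R) (V : set H)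
    (l : {scalar H}) (s : 'rV[R]_n) :
  psd_form b0 -> (forall i, psd_form (b i)) -> 0 < beta ->
  (forall v, beta * `|v| ^+ 2 <= bsigma b0 b (const_mx 1) v v) ->
  fin_dim_subspace V -> pos_orthant s ->
  galerkin_eq b0 b V l s =
    [set galerkin_sol b0 b V l s].
Proof.
move=> p0 pb beta0 coer [m [e VE]] s0.
have def w : bsigma b0 b s w w = 0 -> w = 0.
  rewrite /bsigma => /eqP; rewrite paddr_eq0; last 2 first.
  - exact: p0.
  - by apply: sumr_ge0 => i _; rewrite mulr_ge0 ?pb// ltW// s0.
  case/andP => /eqP b0w; rewrite psumr_eq0; last first.
    by move=> i _; rewrite mulr_ge0 ?pb// ltW// s0.
  move=> /allP bw; have := coer w; rewrite /bsigma b0w add0r big1; last first.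
    move=> i _; have := bw i (mem_index_enum i).
    by rewrite implyTb mulf_eq0 gt_eqF ?s0//= => /eqP ->; rewrite mulr0.
  rewrite pmulr_rle0// => w0; apply/eqP; rewrite -normr_eq0 -sqrf_eq0.
  by rewrite eq_le w0 sqr_ge0.
have Bsuml (c : 'I_m -> R) v : bsigma b0 b s (\sum_j c j *: e j) v =
    \sum_j c j * bsigma b0 b s (e j) v.
  rewrite /bsigma linear_sumlz.
  under eq_bigr => j _ do rewrite linearZl_LR.
  under [X in _ + X]eq_bigr => i _ do rewrite linear_sumlz mulr_sumr.
  rewrite exchange_big -big_split/=; apply: eq_bigr => j _.
  rewrite mulrDr mulr_sumr; congr (_ + _); apply: eq_bigr => i _.
  by rewrite linearZl_LR mulrCA.
have Bsumr (c : 'I_m -> R) v : bsigma b0 b s v (\sum_j c j *: e j) =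
    \sum_j c j * bsigma b0 b s v (e j).
  rewrite /bsigma linear_sumr.
  under eq_bigr => j _ do rewrite linearZr_LR/=.
  under [X in _ + X]eq_bigr => i _ do rewrite linear_sumr mulr_sumr.
  rewrite exchange_big -big_split/=; apply: eq_bigr => j _.
  rewrite mulrDr mulr_sumr; congr (_ + _); apply: eq_bigr => i _.
  by rewrite linearZr_LR/= mulrCA.
have BB u u' v : bsigma b0 b s (u - u') v = bsigma b0 b s u v - bsigma b0 b s u' v.
  rewrite /bsigma linearBl opprD addrACA -sumrB; congr (_ + _).
  by apply: eq_bigr => i _; rewrite linearBl mulrBr.
have uniq u u' : galerkin_eq b0 b V l s u -> galerkin_eq b0 b V l s u' -> u = u'.
  move=> [Vu Eu] [Vu' Eu']; apply/eqP; rewrite -subr_eq0; apply/eqP/def.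
  have Vd : V (u - u').
    move: Vu Vu'; rewrite VE => -[c _ <-] [d _ <-]; exists (c - d) => //.
    by rewrite -sumrB; apply: eq_bigr => j _; rewrite -scalerBl.
  by rewrite BB Eu// Eu'// subrr.
have [u uE] : exists u, galerkin_eq b0 b V l s u.
  pose G := \matrix_(i < m, j < m) bsigma b0 b s (e i) (e j).
  pose L := \row_(j < m) l (e j).
  have /submxP[c LG] : (L <= G)%MS.
    rewrite submxE; apply/eqP/rowP => k; rewrite !mxE.
    pose x := cokermx G ^~ k; pose w := \sum_j x j *: e j.
    have Gx i : \sum_j x j * bsigma b0 b s (e i) (e j) = 0.
      have := congr1 (fun M : 'M[R]_m => M i k) (mulmx_coker G); rewrite !mxE => E.
      by rewrite -[RHS]E; apply: eq_bigr => j _; rewrite [G _ _]mxE mulrC.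
    have w0 : w = 0.
      by apply: def; rewrite Bsuml big1// => i _; rewrite Bsumr Gx mulr0.
    transitivity (l w); last by rewrite w0 linear0.
    by rewrite linear_sum; apply: eq_bigr => j _; rewrite linearZ mxE mulrC.
  exists (\sum_j c ord0 j *: e j); split; first by rewrite VE; exists (c ord0).
  rewrite VE => _ [d _ <-]; rewrite Bsumr linear_sum; apply: eq_bigr => j _.
  rewrite linearZ Bsuml; congr (_ * _).
  have := congr1 (fun M : 'rV[R]_m => M ord0 j) LG; rewrite !mxE => ->.
  by apply: eq_bigr => i _; rewrite mxE.
have gE : galerkin_eq b0 b V l s (galerkin_sol b0 b V l s) by exact: (xgetI 0 uE).
by apply/seteqP; split => [v vE|_ ->//]; exact: uniq.
Qed.

(* Main.v *)
Require Import Defs.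
From HB Require Import structures.
From mathcomp Require Import all_boot all_order all_algebra.
From mathcomp Require Import all_classical all_reals all_analysis.
From mathcomp Require Import lra.
Import Order.TTheory GRing.Theory Num.Theory.
Import numFieldNormedType.Exports.

Set Implicit Arguments.
Unset Strict Implicit.
Unset Printing Implicit Defensive.

Local Open Scope classical_set_scope.
Local Open Scope ring_scope.

(* Galerkin orthogonality gives, without any matrix inversion, the exact identity
     F_{l,r}(t) - F_{l,r}(s) = - sum_i (t_i - s_i) b_i(u_t^l, u_s^r).
   Coercivity bounds u_t^l for t near s, so F_{l,r} is continuous for all
   functionals l and r.  Applied with r := b_i(u_s^r, .), this makes the
   coefficients b_i(u_t^l, u_s^r) continuous in t at s, and the identity becomes
   Caratheodory's criterion for differentiability, with partial derivatives
   - b_i(u_s^l, u_s^r).  On V one can write v = sum_j <p_j, v> e_j, so these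
   partial derivatives are linear combinations of products
   F_{l,<p_j,.>} F_{r,<p_h,.>}; smoothness follows by induction on the order,
   simultaneously for all l and r. *)

(** * Criteria for Frechet differentiability *)

Lemma is_diff_littleo (R : numFieldType) (V W : normedModType R) (f : V -> W)
    (df : {linear V -> W}) (x : V) : continuous df ->
  (forall e, 0 < e ->
    \forall h \near 0, `|f (h + x) - (f x + df h)| <= e * `|h|) ->
  is_diff x f df.
Proof.
move=> dfc fE; have dE : f \o shift x = cst (f x) + df +o_ 0 id.
  by apply/eqaddoP => e e0; exact: fE.
(* Uniqueness of the first-order expansion identifies ['d f x] with [df]. *)
have dF := diff_unique dfc dE.
by split => //; apply/diff_locallyP; rewrite dF.
Qed.

(** [f] and [g] agree at [x] itself as well, so the expansion of [f] there is also one of [g]. *)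
Lemma near_eq_differentiable (R : numFieldType) (V W : normedModType R)
    (f g : V -> W) (x : V) :
  (\forall y \near x, f y = g y) -> differentiable f x -> differentiable g x.
Proof.
move=> fg df; have [dfc dfE] := (diff_locallyP _ _).1 df.
have fgs : \forall h \near 0, f (h + x) = g (h + x).
  by move: fg; rewrite (near_shift 0) subr0.
have [] // : is_diff x g ('d f x).
apply: is_diff_littleo => // e e0; have /eqaddoP/(_ e e0) := dfE.
apply: filterS2 fgs => h fgh.
by rewrite -(nbhs_singleton fg) -fgh.
Qed.

(** The candidate differential: the linear map whose partial derivatives are the [c i]. *)
Definition row_form (R : realType) (W : normedModType R) (n : nat)
    (c : 'I_n -> W) (h : 'rV[R]_n) : W :=
  \sum_(i < n) h ord0 i *: c i.

Fact row_form_is_linear (R : realType) (W : normedModType R) (n : nat)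
    (c : 'I_n -> W) : linear (row_form c).
Proof.
move=> a x y; rewrite /row_form scaler_sumr -big_split/=.
by apply: eq_bigr => i _; rewrite !mxE scalerDl scalerA.
Qed.

HB.instance Definition _ (R : realType) (W : normedModType R) (n : nat)
    (c : 'I_n -> W) :=
  GRing.isLinear.Build R 'rV[R]_n W *:%R (row_form c) (row_form_is_linear c).

Lemma row_form_continuous (R : realType) (W : normedModType R) (n : nat)
    (c : 'I_n -> W) : continuous (row_form c).
Proof.
apply: continuous_big => [|i _ x]; first exact: add_continuous.
by apply: continuousZ; [exact: coord_continuous|exact: cst_continuous].
Qed.

Lemma ler_coord_norm (R : realType) (n : nat) (h : 'rV[R]_n) (i : 'I_n) :
  `|h ord0 i| <= `|h|.
Proof.
rewrite [leRHS]/Num.norm /= mx_normrE; apply/bigmax_geP; right => /=.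
by exists (ord0, i).
Qed.

(** The remainder is the sum of h_i (g_i(s + h) - g_i(s)); it is o(h) because each g_i is continuous
    at s and |h_i| <= |h|. *)
Lemma caratheodory_is_diff (R : realType) (W : normedModType R) (n : nat)
    (F : 'rV[R]_n -> W) (g : 'I_n -> 'rV[R]_n -> W) (s : 'rV[R]_n) :
  (forall i, {for s, continuous (g i)}) ->
  (\forall t \near s, F t = F s + \sum_(i < n) (t - s) ord0 i *: g i t) ->
  is_diff s F (row_form (g^~ s)).
Proof.
move=> gc FE.
apply: is_diff_littleo; first exact: row_form_continuous.
move=> _/posnumP[e].
have FEs : \forall h \near (0 : 'rV[R]_n),
    F (h + s) = F s + \sum_(i < n) h ord0 i *: g i (h + s).
  move: FE; rewrite (near_shift 0) subr0.
  by apply: filterS => h /=; rewrite addrK.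
(* The n errors must add up to at most [e]; dividing by n + 1 also covers n = 0. *)
have gs : \forall h \near (0 : 'rV[R]_n), forall i : 'I_n,
    `|g i (h + s) - g i s| <= e%:num / n.+1%:R.
  have gsi (i : 'I_n) : \forall h \near (0 : 'rV[R]_n),
      `|g i (h + s) - g i s| <= e%:num / n.+1%:R.
    have e1 : 0 < e%:num / n.+1%:R by [].
    have : \forall t \near s, `|g i t - g i s| <= e%:num / n.+1%:R.
      exact: cvgr_distC_le (gc i) _ e1.
    by rewrite (near_shift 0) subr0.
  exact: (filter_forall _ gsi).
near=> h.
have -> : F (h + s) = F s + \sum_(i < n) h ord0 i *: g i (h + s) by near: h.
rewrite opprD addrACA subrr add0r /row_form -sumrB.
rewrite (le_trans (ler_norm_sum _ _ _))//.
apply: (@le_trans _ _ (\sum_(i < n) (e%:num / n.+1%:R * `|h|))).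
  apply: ler_sum => i _; rewrite -scalerBr normrZ mulrC ler_pM//.
    by have := near gs h; apply.
  exact: ler_coord_norm.
rewrite sumr_const card_ord -mulrnAl ler_wpM2r// -mulrnAr ler_piMr//.
by rewrite -[_ *+ n]mulr_natr ler_pdivrMl// mulr1 ler_nat.
Unshelve. all: by end_near. Qed.

(** * Stability of k-fold differentiability on an open set *)

Section TimesDifferentiable.
Context (R : realType) (n : nat) (U : set 'rV[R]_n).
Hypothesis Uopen : open U.
Implicit Types f g : 'rV[R]_n -> R.

(** Since [U] is open, equality on [U] is equality near each of its points, so the partial
    derivatives agree on [U] too and the induction continues. *)
Lemma times_differentiable_eq k f g : {in U, f =1 g} ->
  times_differentiable k U f -> times_differentiable k U g.
Proof.
have near_eq f0 g0 : {in U, f0 =1 g0} ->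
    forall x, U x -> \forall y \near x, f0 y = g0 y.
  move=> fg x Ux; apply: filterS (open_nbhs_nbhs (conj Uopen Ux)) => y Uy.
  by apply: fg; rewrite inE.
elim: k f g => [//|k IH] f g fg [df dDf]; split => [x Ux|i].
  exact: near_eq_differentiable (near_eq _ _ fg x Ux) (df x Ux).
apply: IH (dDf i) => x /[!inE] Ux; apply: near_eq_derive.
exact: near_eq fg x Ux.
Qed.

Lemma times_differentiableS k f :
  times_differentiable k.+1 U f -> times_differentiable k U f.
Proof.
elim: k f => [//|k IH] f [df dDf]; split=> // i; exact: IH (dDf i).
Qed.

Lemma times_differentiable_cst k (c : R) : times_differentiable k U (cst c).
Proof.
elim: k c => [//|k IH] c; split=> [x _|i]; first exact: differentiable_cst.
by apply: times_differentiable_eq (IH 0) => x _; rewrite derive_cst.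
Qed.

Lemma times_differentiableD k f g :
  times_differentiable k U f -> times_differentiable k U g ->
  times_differentiable k U (f + g).
Proof.
elim: k f g => [//|k IH] f g [df dDf] [dg dDg]; split=> [x Ux|i].
  by apply: differentiableD; [exact: df|exact: dg].
apply: times_differentiable_eq (IH _ _ (dDf i) (dDg i)) => x /[!inE] Ux.
by rewrite deriveD//; apply: diff_derivable; [exact: df|exact: dg].
Qed.

Lemma times_differentiableM k f g :
  times_differentiable k U f -> times_differentiable k U g ->
  times_differentiable k U (f * g).
Proof.
elim: k f g => [//|k IH] f g kf kg.
have [df dDf] := kf; have [dg dDg] := kg; split=> [x Ux|i].
  by apply: differentiableM; [exact: df|exact: dg].
(* The Leibniz rule leaves one factor undifferentiated, so that factor is lowered to order [k]. *)
have := times_differentiableD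
  (IH _ _ (times_differentiableS kf) (dDg i))
  (IH _ _ (times_differentiableS kg) (dDf i)).
apply: times_differentiable_eq => x /[!inE] Ux.
by rewrite deriveM//; apply: diff_derivable; [exact: df|exact: dg].
Qed.

Lemma times_differentiable_sum k (I : finType) (f : I -> 'rV[R]_n -> R) :
  (forall i, times_differentiable k U (f i)) ->
  times_differentiable k U (\sum_i f i).
Proof.
move=> df; elim/big_ind : _ => //; first exact: times_differentiable_cst.
exact: times_differentiableD.
Qed.

End TimesDifferentiable.

(** * The positive orthant, and linear coordinates on V *)

Lemma pos_orthant_gt (R : realType) (n : nat) (s : 'rV[R]_n) : pos_orthant s ->
  exists c : R, [/\ 0 < c, c <= 1 &
    \forall t \near s, forall i : 'I_n, c < (t : 'rV[R]_n) ord0 i].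
Proof.
move=> s0.
have [c [[c0 c1] cs]] : exists c : R, (0 < c /\ c <= 1) /\ forall i, c < s ord0 i.
  (* Every small enough c > 0 works; [c <= 1] will let c b0 <= b0 on the diagonal. *)
  apply: (@filter_ex _ (0 : R)^'+); apply: filterI.
    by apply: filterI; [exact: nbhs_right_gt|exact: nbhs_right_le].
  have cs (i : 'I_n) : \forall c \near (0 : R)^'+, c < s ord0 i.
    exact: nbhs_right_lt.
  exact: (filter_forall _ cs).
exists c; split=> //.
have ct (i : 'I_n) : \forall t \near s, c < (t : 'rV[R]_n) ord0 i.
  exact: cvgr_gt _ (@coord_continuous R 1 n ord0 i s) _ (cs i).
exact: (filter_forall _ ct).
Qed.

Lemma pos_orthant_open (R : realType) (n : nat) : open (@pos_orthant R n).
Proof.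
rewrite openE => s /pos_orthant_gt[c [c0 _ ct]].
by apply: filterS ct => t ct i; exact: lt_trans (ct i).
Qed.

(* The Gram matrix of the spanning family e may be singular, so its inverse is
   replaced by a partial inverse. *)
Lemma fin_dim_coordinates (R : realType) (H : lmodType R)
    (ip : {dot H for idfun}) (V : set H) : fin_dim_subspace V ->
  exists (m : nat) (e p : 'I_m -> H),
    forall v, V v -> v = \sum_j ip (p j) v *: e j.
Proof.
move=> [m [e ->]]; pose G : 'M[R]_m := \matrix_(j, k) ip (e j) (e k).
exists m, e, (fun j => \sum_k pinvmx G k j *: e k) => _ [c _ <-].
set v := \sum_(j < m) c j *: e j.
pose y : 'rV_m := (\row_j c j) *m G.
have yE k : y ord0 k = ip v (e k).
  rewrite mxE linear_sumlz; apply: eq_bigr => j _.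
  by rewrite !mxE linearZl_LR.
have symE u w : ip u w = ip w u by rewrite hermC expr0 mul1r.
pose d := y *m pinvmx G.
have dE j : ip (\sum_k pinvmx G k j *: e k) v = d ord0 j.
  rewrite mxE linear_sumlz; apply: eq_bigr => k _.
  by rewrite linearZl_LR yE symE mulrC.
under eq_bigr => j _ do rewrite dE.
set w := \sum_j _.
have wE k : ip (v - w) (e k) = 0.
  rewrite linearBl/= -yE; apply/eqP; rewrite subr_eq0; apply/eqP.
  (* [y] lies in the row space of [G] by construction, so the partial inverse is exact on it. *)
  have <- : d *m G = y by rewrite mulmxKpV// submxMl.
  rewrite mxE linear_sumlz; apply: eq_bigr => j _.
  by rewrite [G _ _]mxE linearZl_LR.
(* [v - w] is a combination of the [e k], all orthogonal to it, hence orthogonal to itself. *)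
apply/eqP; rewrite -subr_eq0; apply: contraT => /(neq0_dnorm_gt0 (s := ip)).
have wE' (a : 'I_m -> R) : ip (v - w) (\sum_j a j *: e j) = 0.
  by rewrite linear_sumr big1// => j _; rewrite linearZr_LR/= wE mulr0.
by rewrite linearBr/= !wE' subr0 ltxx.
Qed.


(** * Galerkin solutions: shift identity, local bounds, continuity *)

Section Galerkin.
Context (R : realType) (H : normedModType R) (ip : {dot H for idfun}) (n : nat).
Context (b0 : {symmetric H}) (b : 'I_n -> {symmetric H}) (beta : R) (V : set H).
Hypothesis ip_norm : hilbert_norm ip.
Hypothesis b0_psd : psd_form b0.
Hypothesis b_bounded : forall i, bounded_form (b i).
Hypothesis b_psd : forall i, psd_form (b i).
Hypothesis beta_gt0 : 0 < beta.
Hypothesis coercive : forall v, beta * `|v| ^+ 2 <= bsigma b0 b (const_mx 1) v v.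
Hypothesis V_fin_dim : fin_dim_subspace V.

Local Notation bs := (bsigma b0 b).
Local Notation sol := (galerkin_sol b0 b V).
Local Notation F := (F_map b0 b V).

Lemma galerkin_solP (l : {scalar H}) (s : 'rV[R]_n) : pos_orthant s ->
  V (sol l s) /\ forall v, V v -> bs s (sol l s) v = l v.
Proof.
move=> s0.
have := galerkin_sol_unique l b0_psd b_psd beta_gt0 coercive V_fin_dim s0.
by move/seteqP => [_ /(_ _ erefl)].
Qed.

Lemma symmetricC (f : {symmetric H}) u v : f u v = f v u.
Proof. by rewrite hermC expr0 mul1r. Qed.

Lemma bsigmaC s u v : bs s u v = bs s v u.
Proof.
rewrite /bsigma symmetricC; congr (_ + _).
by apply: eq_bigr => i _; rewrite symmetricC.
Qed.

Lemma bsigma_shift s t u v :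
  bs t u v = bs s u v + \sum_(i < n) (t - s) ord0 i * b i u v.
Proof.
rewrite /bsigma -addrA -big_split/=; congr (_ + _).
by apply: eq_bigr => i _; rewrite !mxE mulrBl addrC subrK.
Qed.

(** On the diagonal b_t dominates c b_1: all forms are nonnegative there, [c <= 1] handles b0 and c
    < t_i the others. *)
Lemma bsigma_coercive (c : R) (t : 'rV[R]_n) (v : H) :
  0 < c -> c <= 1 -> (forall i, c < t ord0 i) ->
  c * beta * `|v| ^+ 2 <= bs t v v.
Proof.
move=> c0 c1 ct; rewrite -mulrA.
apply: (le_trans (ler_wpM2l (ltW c0) (coercive v))).
rewrite /bsigma mulrDr lerD//; first by rewrite ler_piMl// b0_psd.
rewrite mulr_sumr; apply: ler_sum => i _.
by rewrite mxE mul1r ler_wpM2r ?b_psd// ltW.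
Qed.

Lemma F_mapE (l r : {scalar H}) s : pos_orthant s ->
  F l r s = bs s (sol l s) (sol r s).
Proof.
move=> s0; have [Vl _] := galerkin_solP l s0; have [_ rE] := galerkin_solP r s0.
by rewrite bsigmaC rE.
Qed.

(** Testing the equations of [sol l s] and [sol l t] with [sol r s] gives the same value of [l];
    passing from b_t to b_s costs the sum, and b_s(u_t^l, u_s^r) is F at t. *)
Lemma F_map_shift (l r : {scalar H}) s t : pos_orthant s -> pos_orthant t ->
  F l r t = F l r s - \sum_(i < n) (t - s) ord0 i * b i (sol l t) (sol r s).
Proof.
move=> s0 t0; have [Vr rE] := galerkin_solP r s0.
have [Vl lE] := galerkin_solP l s0; have [Vt tE] := galerkin_solP l t0.
apply/eqP; rewrite eq_sym subr_eq F_mapE// lE// -tE//.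
by rewrite (bsigma_shift s) bsigmaC rE.
Qed.

Lemma sol_locally_bounded (l : {scalar H}) s : pos_orthant s ->
  exists K : R, \forall t \near s, `|sol l t| <= K.
Proof.
move=> s0; have [c [c0 c1 ct]] := pos_orthant_gt s0.
have [m [e [p pE]]] := fin_dim_coordinates ip V_fin_dim.
(* The representer of [l] on V, read off from the coordinates. *)
pose q := \sum_j l (e j) *: p j.
have lE v : V v -> l v = ip q v.
  move=> Vv; rewrite {1}(pE _ Vv) linear_sum linear_sumlz.
  by apply: eq_bigr => j _; rewrite linearZ linearZl_LR mulrC.
have k0 : 0 < c * beta by rewrite mulr_gt0.
exists (`|q| / (c * beta)); apply: filterS ct => t ct.
have t0 : pos_orthant t by move=> i; exact: lt_trans (ct i).
have [Vu uE] := galerkin_solP l t0.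
have := bsigma_coercive (sol l t) c0 c1 ct; rewrite uE// lE// => kle.
move: (c * beta) k0 kle => k k0 kle; set u := sol l t in kle *.
(* 0 <= |q - k u|^2 stands in for the Cauchy-Schwarz inequality *)
have : 0 <= ip (q - k *: u) (q - k *: u) by rewrite -ip_norm sqr_ge0.
rewrite !(linearBl, linearBr)/= !(linearZl_LR, linearZr_LR)/= -!ip_norm.
rewrite (_ : ip u q = ip q u); last by rewrite hermC expr0 mul1r.
move=> sq; rewrite ler_pdivlMr// mulrC -(@ler_pXn2r _ 2) ?nnegrE ?mulr_ge0 ?(ltW k0)//.
(* |q|^2 >= 2k (q,u) - k^2 |u|^2 >= k^2 |u|^2, the last step by k times [kle]. *)
by have := ler_wpM2l (ltW k0) kle; move: sq; rewrite /GRing.scale/=; nra.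
Qed.

(** The shift identity, with [sol l t] bounded near s, gives a Lipschitz estimate at s. *)
Lemma F_map_continuous (l r : {scalar H}) s : pos_orthant s ->
  {for s, continuous (F l r)}.
Proof.
move=> s0; have [K uK] := sol_locally_bounded l s0.
have [M bM] := choice b_bounded.
(* Absolute values are taken because a constant of [bounded_form] may be negative. *)
pose C := \sum_(i < n) `|M i| * K * `|sol r s|.
have dF : \forall t \near s, `|F l r s - F l r t| <= `|t - s| * C.
  have : \forall t \near s, pos_orthant t.
    exact: open_nbhs_nbhs (conj (@pos_orthant_open R n) s0).
  apply: filterS2 uK => t uK t0.
  rewrite (F_map_shift _ _ s0 t0) opprB addrC subrK mulr_sumr.
  apply: le_trans (ler_norm_sum _ _ _) _; apply: ler_sum => i _.
  rewrite normrM ler_pM ?ler_coord_norm//.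
  apply: le_trans (bM i _ _) _; rewrite ler_wpM2r//.
  apply: (@le_trans _ _ (`|M i| * `|sol l t|)).
    by rewrite ler_wpM2r ?ler_norm.
  by rewrite ler_wpM2l.
apply/(@cvgrPdist_le _ R^o _ (nbhs s) _ (F l r)) => e e0.
have e1 : 0 < e / (`|C| + 1) by rewrite divr_gt0// ltr_wpDl.
have ts : \forall t \near s, `|t - s| <= e / (`|C| + 1).
  exact: (@cvgr_distC_le R 'rV[R]_n _ (nbhs s) _ id s cvg_id _ e1).
near=> t.
have dt : `|t - s| <= e / (`|C| + 1) by near: t.
have Ft : `|F l r s - F l r t| <= `|t - s| * C by near: t.
apply: (le_trans Ft); apply: (@le_trans _ _ (`|t - s| * (`|C| + 1))).
  by rewrite ler_wpM2l// (le_trans (ler_norm C))// lerDl.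
by rewrite -ler_pdivlMr// ltr_wpDl.
Unshelve. all: by end_near. Qed.

(** * Derivatives of F of all orders *)

Lemma F_map_is_diff (l r : {scalar H}) s : pos_orthant s ->
  is_diff s (F l r) (row_form (fun i => - b i (sol l s) (sol r s))).
Proof.
move=> s0.
apply: (@caratheodory_is_diff R R^o n (F l r)
  (fun i t => - b i (sol l t) (sol r s)) s).
  move=> i; apply: continuousN.
  have -> : (fun t => b i (sol l t) (sol r s)) = F l (b i (sol r s)).
    by apply/funext => t; rewrite symmetricC.
  exact: F_map_continuous.
have : \forall t \near s, pos_orthant t.
  exact: open_nbhs_nbhs (conj (@pos_orthant_open R n) s0).
apply: filterS => t t0; rewrite (F_map_shift _ _ s0 t0) -sumrN.
by congr (_ + _); apply: eq_bigr => i _; rewrite scalerN.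
Qed.

Lemma row_form_delta (W : normedModType R) (c : 'I_n -> W) i :
  row_form c (delta_mx ord0 i) = c i.
Proof.
rewrite /row_form (bigD1 i)//= big1 ?addr0 => [|j ji].
  by rewrite mxE !eqxx scale1r.
by rewrite mxE (negbTE ji) andbF scale0r.
Qed.

Lemma F_map_is_derive (l r : {scalar H}) s i : pos_orthant s ->
  is_derive s (delta_mx ord0 i) (F l r) (- b i (sol l s) (sol r s)).
Proof.
move=> s0; have [dF dFE] := F_map_is_diff l r s0.
split; first exact: diff_derivable.
by rewrite deriveE// dFE row_form_delta.
Qed.

Lemma F_map_smooth (l r : {scalar H}) :
  infinitely_differentiable (@pos_orthant R n) (F l r).
Proof.
have [m [e [p pE]]] := fin_dim_coordinates ip V_fin_dim.
have opn := @pos_orthant_open R n.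
move=> k; elim: k l r => [//|k IH] l r; split=> [s s0|i].
  by have [] := F_map_is_diff l r s0.
(* The i-th partial derivative with both solutions expanded along [e]: the coordinates of [sol l s]
   are the values at s of [F l (ip (p j))], to which [IH] applies. *)
have : times_differentiable k (@pos_orthant R n)
    (\sum_(j < m) \sum_(h < m) cst (- b i (e j) (e h)) *
       (F l (ip (p j)) * F r (ip (p h)))).
  apply: (times_differentiable_sum opn) => j.
  apply: (times_differentiable_sum opn) => h.
  apply: (times_differentiableM opn); first exact: times_differentiable_cst.
  by apply: (times_differentiableM opn); exact: IH.
apply: (times_differentiable_eq opn).
move=> s /[!inE] s0; have [_ ->] := F_map_is_derive l r i s0.
have [Vl _] := galerkin_solP l s0; have [Vr _] := galerkin_solP r s0.
rewrite [X in b i X _]pE// [X in b i _ X]pE// linear_sumlz fct_sumE -sumrN.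
apply: eq_bigr => j _; rewrite linear_sumr fct_sumE -sumrN.
apply: eq_bigr => h _; rewrite linearZl_LR linearZr_LR/=.
by rewrite [in RHS]mulrA [in RHS]mulrC -mulNr.
Qed.

End Galerkin.

Theorem lemma3 (R : realType) (H : completeNormedModType R)
    (ip : {dot H for idfun}) (ip_norm : hilbert_norm ip)
    (n : nat) (b0 : {symmetric H}) (b : 'I_n -> {symmetric H})
    (b0_bounded : bounded_form b0) (b0_psd : psd_form b0)
    (b_bounded : forall i : 'I_n, bounded_form (b i))
    (b_psd : forall i : 'I_n, psd_form (b i))
    (beta C : R) (beta_gt0 : 0 < beta) (C_gt0 : 0 < C)
    (b1_bounds : forall v : H,
        beta * `|v| ^+ 2 <= bsigma b0 b (const_mx 1) v v <= C * `|v| ^+ 2)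
    (V : set H) (V_fin_dim : fin_dim_subspace V)
    (l r : {scalar H}) (l_cont : continuous l) (r_cont : continuous r) :
  (forall s : 'rV[R]_n, pos_orthant s ->
     F_map b0 b V l r s =
       bsigma b0 b s (galerkin_sol b0 b V l s) (galerkin_sol b0 b V r s)) /\
  infinitely_differentiable (@pos_orthant R n) (F_map b0 b V l r) /\
  (forall s : 'rV[R]_n, pos_orthant s -> forall i : 'I_n,
     is_derive s (delta_mx ord0 i) (F_map b0 b V l r)
       (- b i (galerkin_sol b0 b V l s) (galerkin_sol b0 b V r s))).
Proof.
have coer v : beta * `|v| ^+ 2 <= bsigma b0 b (const_mx 1) v v.
  by have /andP[] := b1_bounds v.
split; first by move=> s; exact: F_mapE b0_psd b_psd beta_gt0 coer V_fin_dim l r s.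
split.
  exact: F_map_smooth ip_norm b0_psd b_bounded b_psd beta_gt0 coer V_fin_dim l r.
move=> s s0 i.
exact: F_map_is_derive ip_norm b0_psd b_bounded b_psd beta_gt0 coer V_fin_dim l r
  s i s0.
Qed.
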